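(* Let $p,q,a$ be integers with $1<q<p$, $0\le a<p$ and $\gcd(p,q)=1$. Let $n\ge0$, let $s_1,\dots,s_{n+1}\in\{-1,1\}$, and let $r_{-1},r_0,\dots,r_{n+1}$, $c_1,\dots,c_{n+1}$, $\beta_0,\dots,\beta_n$, $\gamma_0,\dots,\gamma_{n+1}$ be nonnegative integers with $r_{-1}=p$, $r_0=q$, $\gamma_0=(a)_p$ (so $\gamma_0=a$), such that for all $0\le i\le n$ $$r_{i-1}=c_{i+1}\,r_i+s_{i+1}\,r_{i+1},\qquad \gamma_i=\beta_i\,r_i-s_{i+1}\,\gamma_{i+1},\qquad 0\le r_{i+1}<r_i,\qquad 0\le\gamma_{i+1}<r_i .$$ Define $f_0=1$, $f_1=c_1$ and $f_i=c_i f_{i-1}+s_{i-1}f_{i-2}$ for $2\le i\le n$. If $n$ is such that $r_n=1$ or $\gamma_{n+1}=0$, then $$(a(q^{-1})_p)_p=\sum_{i=0}^{n}\frac{p\,\gamma_i}{r_{i-1}r_i}\qquad\text{and}\qquad (a(q^{-1})_p)_p=\sum_{i=0}^{n} f_i\,\beta_i .$$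
   Context: For integers $a$ and $m\neq0$, $(a)_m:=a-m\lfloor a/m\rfloor$. For coprime integers $q,p$ with $p>0$ and an integer $a$, the extended modular inverse $(a(q^{-1})_p)_p$ is $(x)_p$, where $x$ is any integer with $qx\equiv a\pmod p$; equivalently, it is the unique integer $x$ with $0\le x<p$ and $qx\equiv a\pmod p$. *)

(* Defs.v *)
From mathcomp Require Import all_boot all_order all_algebra.

Set Implicit Arguments.
Unset Strict Implicit.
Unset Printing Implicit Defensive.

Import Order.TTheory GRing.Theory Num.Theory.
Local Open Scope ring_scope.

(* (a)_m := a - m * floor (a / m). For m < 0 this differs from (a %% m)%Z,
   whose value is never negative; for m > 0 they agree (fmodE below). *)
Definition fmod (a m : int) : int := a - m * Num.floor (a%:Q / m%:Q).

(* (a (q^-1)_p)_p: the integer x with 0 <= x < p and q * x = a modulo p, for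
   coprime q and p > 0; `|p|%N is p itself when p > 0. The value 0 of the
   last branch occurs only when no such x exists; ext_modinvP and
   ext_modinv_fmod show that this is the intended number. *)
Definition ext_modinv (a q p : int) : int :=
  if [pick x : 'I_(`|p|%N) | (q * (x : nat)%:Z == a %[mod p])%Z] is Some x
  then (x : nat)%:Z else 0.

Fixpoint fseq (c s : nat -> int) (i : nat) {struct i} : int :=
  match i with
  | 0%N => 1
  | j.+1 => match j with
            | 0%N => c 1%N
            | k.+1 => c i * fseq c s j + s j * fseq c s k
            end
  end.

Lemma fmodE (a m : int) : 0 < m -> fmod a m = (a %% m)%Z.
Proof.
move=> m_gt0; have mQ : 0 < m%:Q by rewrite ltr0z.
rewrite /fmod; suff -> : Num.floor (a%:Q / m%:Q) = (a %/ m)%Z.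
  by rewrite {1}(divz_eq a m) mulrC addrAC subrr add0r.
apply: floor_def; rewrite ler_pdivlMr // ltr_pdivrMr //.
rewrite -!rmorphM /= ler_int ltr_int lez_floor ?gt_eqF //=.
by rewrite ltz_ceil.
Qed.

Lemma ext_modinvP (a q p x : int) : 0 < p -> coprimez q p ->
  x = ext_modinv a q p <-> 0 <= x < p /\ (q * x = a %[mod p])%Z.
Proof.
move=> p_gt0 qp; have p_neq0 : p != 0 by rewrite gt_eqF.
have absp : (`|p|%N)%:Z = p by rewrite gez0_abs // ltW.
have spec : 0 <= ext_modinv a q p < p /\
            (q * ext_modinv a q p = a %[mod p])%Z.
  rewrite /ext_modinv; case: pickP => [y /eqP qy | no].
    by split=> //; rewrite le0z_nat /= -[X in _ < X]absp ltz_nat ltn_ord.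
  case/coprimezP: qp => -[u v] /= uv.
  have xlt : (`|(u * a %% p)%Z| < `|p|)%N.
    by rewrite -ltz_nat absp gez0_abs ?modz_ge0 // ltz_pmod.
  have := no (Ordinal xlt); rewrite /= gez0_abs ?modz_ge0 // modzMmr.
  suff -> : q * (u * a) = - (a * v) * p + a by rewrite modzMDl eqxx.
  rewrite -[X in _ = _ + X]mulr1 -uv mulrDr mulNr addrC -[a * v * p]mulrA addrK.
  by rewrite mulrCA [RHS]mulrCA (mulrC q).
split=> [-> // | [x_bnd qx]]; case: spec; move: (ext_modinv a q p) => y y_bnd qy.
have : (q * x == q * y %[mod p])%Z by rewrite qx qy.
rewrite eqz_mod_dvd -mulrBr Gauss_dvdzr; last by rewrite coprimez_sym.
by rewrite -eqz_mod_dvd !modz_small // => /eqP.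
Qed.

Lemma ext_modinv_fmod (a q p x : int) : 0 < p -> coprimez q p ->
  (q * x = a %[mod p])%Z -> ext_modinv a q p = fmod x p.
Proof.
move=> p_gt0 qp qx; apply/esym/ext_modinvP; rewrite // fmodE //.
by rewrite modz_ge0 ?gt_eqF // ltz_pmod // modzMmr.
Qed.

(* Main.v *)
(* The tail sums T_i = \sum_(j >= i) r_(i-1) gamma_j / (r_(j-1) r_j) obey
   T_i = beta_i + c_(i+1) T_(i+1) + s_(i+1) T_(i+2), hence are integers, and
   r_i T_i = gamma_i + r_(i-1) T_(i+1). At i = 0 the latter reads
   q T_0 = a + p T_1, so T_0 solves the congruence; descending from the end
   of the sequence it also gives 0 <= T_i < r_(i-1), so T_0 is the modular
   inverse. Divided by r_(i-1) r_i it telescopes to the first formula, while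
   unrolling the recurrence from i = 0 produces the coefficients f_i. *)

Require Import Defs.
From mathcomp Require Import all_boot all_order all_algebra.
From mathcomp Require Import zify ring.

Set Implicit Arguments.
Unset Strict Implicit.
Unset Printing Implicit Defensive.

Import Order.TTheory GRing.Theory Num.Theory.
Local Open Scope ring_scope.

(** The recurrence determines [T] downwards from two zero end values, so all values stay integral.
    Induction on [m] is run for all coefficient sequences: the solution for the sequences shifted by
    one is prefixed with a new head. *)
Lemma backward_rec_exists (m : nat) (b c s : nat -> int) :
  exists T : nat -> int, [/\ T m = 0, T m.+1 = 0 &
    forall i, (i < m)%N -> T i = b i + c i.+1 * T i.+1 + s i.+1 * T i.+2].
Proof.
elim: m b c s => [|m IHm] b c s; first by exists (fun=> 0).
have [T [Tm TmS Trec]] := IHm (b \o S) (c \o S) (s \o S).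
exists (fun i => if i is j.+1 then T j else b 0%N + c 1%N * T 0%N + s 1%N * T 1%N).
by split=> // -[|i] // /Trec.
Qed.

Lemma fseqSS (c s : nat -> int) (k : nat) :
  fseq c s k.+2 = c k.+2 * fseq c s k.+1 + s k.+1 * fseq c s k.
Proof. by []. Qed.

Section BackwardRecurrence.

Variables (m : nat) (b c s T : nat -> int).
Hypothesis Tm : T m = 0.
Hypothesis TmS : T m.+1 = 0.
Hypothesis Trec :
  forall i, (i < m)%N -> T i = b i + c i.+1 * T i.+1 + s i.+1 * T i.+2.

(** Expanding [T k.+1] once more turns the coefficient of [T k.+2] into [c k.+2 * fseq c s k.+1 + s
    k.+1 * fseq c s k], which is [fseq c s k.+2]. *)
Lemma backward_rec_unroll (k : nat) : (k < m)%N ->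
  T 0%N = \sum_(0 <= i < k.+1) fseq c s i * b i
          + fseq c s k.+1 * T k.+1 + s k.+1 * fseq c s k * T k.+2.
Proof.
elim: k => [|k IHk] km.
  by rewrite big_nat1 Trec //=; ring.
by rewrite IHk 1?ltnW // (Trec km) (fseqSS c s k) [in RHS]big_nat_recr //=; ring.
Qed.

Lemma backward_rec_fseq : T 0%N = \sum_(0 <= i < m) fseq c s i * b i.
Proof.
case: m Tm TmS backward_rec_unroll => [|k] TkS TkSS unroll.
  by rewrite big_nil.
by rewrite (unroll k) // TkS TkSS !mulr0 !addr0.
Qed.

(* R i stands for r_(i-1). *)
Variables R g : nat -> int.
Hypothesis Rrec :
  forall i, (i < m)%N -> R i = c i.+1 * R i.+1 + s i.+1 * R i.+2.
Hypothesis grec : forall i, (i < m)%N -> g i = b i * R i.+1 - s i.+1 * g i.+1.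
Hypothesis gm : g m = 0.

(** Downward induction from [i = m], where [gm] makes both sides vanish. The case [i.+1] expresses
    [g i.+1] through [T]; after substitution the terms in [s i.+1 * R i.+2 * T i.+1] cancel. *)
Lemma backward_rec_step (i : nat) :
  (i <= m)%N -> R i.+1 * T i = g i + R i * T i.+1.
Proof.
move/subnK; move: (m - i)%N => k; elim: k i => [|k IHk] i.
  by rewrite add0n => ->; rewrite Tm TmS gm !mulr0 addr0.
move=> kim; have im : (i < m)%N by rewrite -kim addSn ltnS leq_addl.
have := IHk i.+1; rewrite addnS -addSn => /(_ kim) stepS.
have stepS' : g i.+1 = R i.+2 * T i.+1 - R i.+1 * T i.+2 by rewrite stepS addrK.
by rewrite (Trec im) (grec im) (Rrec im) stepS'; ring.
Qed.

Hypothesis Rgt0 : forall i, (i <= m)%N -> 0 < R i.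
Hypothesis g_bnd : forall i, (i <= m)%N -> 0 <= g i < R i.

Lemma backward_rec_bound (i : nat) : (i <= m)%N -> 0 <= T i < R i.
Proof.
move/subnK; move: (m - i)%N => k; elim: k i => [|k IHk] i.
  by rewrite add0n => ->; rewrite Tm lexx Rgt0.
move=> kim; have im : (i < m)%N by rewrite -kim addSn ltnS leq_addl.
have := IHk i.+1; rewrite addnS -addSn => /(_ kim) /andP[TS_ge0 TS_lt].
have step := backward_rec_step (ltnW im).
have /andP[g_ge0 g_lt] := g_bnd (ltnW im).
have R_gt0 := Rgt0 (ltnW im); have RS_gt0 := Rgt0 im.
apply/andP; split.
  by rewrite -(pmulr_rge0 _ RS_gt0) step addr_ge0 // mulr_ge0 // ltW.
(* Integrality enters here: [T i.+1 < R i.+1] gives [T i.+1 + 1 <= R i.+1], which absorbs the term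
   [g i < R i]. *)
rewrite -(ltr_pM2l RS_gt0) step; apply: lt_le_trans (_ : R i + R i * T i.+1 <= _).
  by rewrite ltrD2r.
have -> : R i + R i * T i.+1 = R i * (T i.+1 + 1) by ring.
by rewrite [leRHS]mulrC ler_pM2l // lezD1.
Qed.

(** Each summand is [R 0] times the difference of [T i / R i] and [T i.+1 / R i.+1]. *)
Lemma backward_rec_sum_ratio :
  (T 0%N)%:Q =
    \sum_(0 <= i < m) ((R 0%N)%:Q * (g i)%:Q) / ((R i)%:Q * (R i.+1)%:Q).
Proof.
have RQ i : (i <= m)%N -> (R i)%:Q != 0.
  by move=> im; rewrite intr_eq0 gt_eqF // Rgt0.
transitivity (- ((R 0%N)%:Q * ((T m)%:Q / (R m)%:Q
                               - (T 0%N)%:Q / (R 0%N)%:Q))).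
  by rewrite Tm mul0r sub0r mulrN opprK mulrCA divff ?mulr1 ?RQ.
rewrite -(telescope_sumr (fun i => (T i)%:Q / (R i)%:Q)) // mulr_sumr -sumrN.
apply: eq_big_nat => i /andP[_ im].
have -> : (g i)%:Q = (R i.+1)%:Q * (T i)%:Q - (R i)%:Q * (T i.+1)%:Q.
  by rewrite -!intrM backward_rec_step 1?ltnW // rmorphD /= addrK.
by field; rewrite !RQ // ltnW.
Qed.

End BackwardRecurrence.

Theorem theorem3p4 (p q a : int) (n : nat)
    (s : nat -> int) (r : int -> int) (c beta gamma : nat -> int) :
  1 < q -> q < p -> 0 <= a -> a < p -> gcdz p q = 1 ->
  (forall i : nat, (1 <= i <= n.+1)%N -> s i = -1 \/ s i = 1) ->
  (forall i : int, -1 <= i <= n.+1%:Z -> 0 <= r i) ->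
  (forall i : nat, (1 <= i <= n.+1)%N -> 0 <= c i) ->
  (forall i : nat, (i <= n)%N -> 0 <= beta i) ->
  (forall i : nat, (i <= n.+1)%N -> 0 <= gamma i) ->
  r (-1) = p -> r 0 = q -> gamma 0%N = fmod a p ->
  (forall i : nat, (i <= n)%N ->
     [/\ r (i%:Z - 1) = c i.+1 * r i%:Z + s i.+1 * r (i%:Z + 1),
         gamma i = beta i * r i%:Z - s i.+1 * gamma i.+1,
         0 <= r (i%:Z + 1) < r i%:Z
       & 0 <= gamma i.+1 < r i%:Z]) ->
  r n%:Z = 1 \/ gamma n.+1 = 0 ->
  (ext_modinv a q p)%:Q =
    \sum_(0 <= i < n.+1)
       (p%:Q * (gamma i)%:Q) / ((r (i%:Z - 1))%:Q * (r i%:Z)%:Q)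
  /\ ext_modinv a q p = \sum_(0 <= i < n.+1) fseq c s i * beta i.
Proof.
move=> q_gt1 q_lt_p a_ge0 a_lt_p pq1 _ _ _ _ _ rp rq g0 recs last.
have p_gt0 : 0 < p by apply: lt_trans q_lt_p; apply: lt_trans q_gt1.
have ga : gamma 0%N = a by rewrite g0 fmodE // modz_small // a_ge0.
(* Both stopping conditions reduce to this one: if [r n = 1], then [0 <= gamma n.+1 < 1]. *)
have gl : gamma n.+1 = 0.
  case: last => // rn1; have [_ _ _] := recs n (leqnn n).
  by rewrite rn1; lia.
pose R (i : nat) : int := r (i%:Z - 1).
have RS i : R i.+1 = r i%:Z by rewrite /R -addn1 PoszD addrK.
have RSS i : R i.+2 = r (i%:Z + 1) by rewrite RS -addn1 PoszD.
have R0 : R 0%N = p by rewrite /R sub0r.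
have R1 : R 1%N = q by rewrite RS.
have Rrec i : (i < n.+1)%N -> R i = c i.+1 * R i.+1 + s i.+1 * R i.+2.
  by rewrite ltnS => /recs[rE _ _ _]; rewrite RS RSS -rE.
have grec i : (i < n.+1)%N ->
    gamma i = beta i * R i.+1 - s i.+1 * gamma i.+1.
  by rewrite ltnS => /recs[_ gE _ _]; rewrite RS.
(* The range ends at [R n.+1], which is [r n]; the next remainder may be zero. *)
have Rgt0 i : (i <= n.+1)%N -> 0 < R i.
  case: i => [|i]; first by rewrite R0.
  by rewrite ltnS => /recs[_ _ /andP[r_ge0 r_lt] _]; rewrite RS (le_lt_trans r_ge0).
have g_bnd i : (i <= n.+1)%N -> 0 <= gamma i < R i.
  case: i => [|i]; first by rewrite R0 ga a_ge0.
  by rewrite ltnS => /recs[]; rewrite RS.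
have [T [Tm TmS Trec]] := backward_rec_exists n.+1 beta c s.
have -> : ext_modinv a q p = T 0%N.
  apply/esym/ext_modinvP => //; first by rewrite coprimez_sym; apply/eqP.
  split.
    by rewrite -R0 (backward_rec_bound Tm TmS Trec Rrec grec gl Rgt0 g_bnd).
  rewrite -R1 (backward_rec_step Tm TmS Trec Rrec grec gl) //.
  by rewrite ga R0 addrC mulrC modzMDl.
split; last exact: backward_rec_fseq Tm TmS Trec.
rewrite (backward_rec_sum_ratio Tm TmS Trec Rrec grec gl Rgt0) R0.
by apply: eq_bigr => i _; rewrite RS.
Qed.
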